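(* Let $X$ be a set, $I$ a nonempty finite set, and $\mathcal{F}=(f_i)_{i\in I}$, $f_i:X\to X$, a family of functions having attractor. Let $M>0$, the sequences $\mu_n$ ($n\in\mathbb{N}$), $\eta$, $(c_n)_{n\in\mathbb{N}}$ and the functions $\delta=d^\eta$ and $d:X\times X\to[0,\infty)$, $$d(x,y)=\sup_{\alpha\in\Lambda^*(I)}c_{|\alpha|}\,\delta(f_\alpha(x),f_\alpha(y)),$$ be as described in the context. Then $(X,d)$ is a bounded and complete metric space.
   Context: $\mathbb{N}=\{0,1,2,\dots\}$ and $\mathbb{N}^*=\{1,2,\dots\}$. $\Lambda(I)=I^{\mathbb{N}^*}$ is the set of infinite words with letters in $I$; $\Lambda^*(I)$ is the set of all finite words with letters in $I$, including the empty word $\lambda$; $|\alpha|$ is the length of a finite word $\alpha$. For $\alpha=\alpha_1\alpha_2\dots\in\Lambda(I)$, $[\alpha]_n=\alpha_1\dots\alpha_n$ if $n\ge 1$ and $[\alpha]_0=\lambda$. Put $f_\lambda=\mathrm{Id}_X$, $f_{\alpha_1\dots\alpha_m}=f_{\alpha_1}\circ\dots\circ f_{\alpha_m}$, and $X_\alpha=f_\alpha(X)$ for $\alpha\in\Lambda^*(I)$. Family having attractor: $(f_i)_{i\in I}$ ($I$ finite) has attractor if: (a) for every $\alpha\in\Lambda(I)$ the set $\bigcap_{n\in\mathbb{N}}X_{[\alpha]_n}$ has a unique element, denoted $a_\alpha$; (b) if $a_\alpha\ne a_\beta$, then there exists $n_0\in\mathbb{N}$ with $X_{[\alpha]_{n_0}}\cap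 X_{[\beta]_{n_0}}=\emptyset$. The attractor is $A=\{a_\alpha\mid\alpha\in\Lambda(I)\}$. For $\alpha\in\Lambda^*(I)$: $Y_\alpha=\{a_\beta\mid \beta\in\Lambda(I),\ X_\alpha\cap X_{[\beta]_n}\ne\emptyset\text{ for every }n\in\mathbb{N}\}$ and $\widetilde{X_\alpha}=X_\alpha\cup Y_\alpha$. For a sequence $\mu=(z_n)_{n\in\mathbb{N}}$ with $0<z_{n+1}\le z_n$ for all $n$, $d^\mu:X\times X\to[0,\infty)$ is defined by $d^\mu(x,y)=0$ if $x=y$, and $d^\mu(x,y)=\inf M_{x,y}$ if $x\ne y$, where $M_{x,y}$ is the set of all sums $\sum_{i=0}^p z_{|\alpha_i|}$ with $p\in\mathbb{N}$ and $\alpha_0,\dots,\alpha_p\in\Lambda^*(I)$ such that $x\in\widetilde{X_{\alpha_0}}$, $y\in\widetilde{X_{\alpha_p}}$ and $\widetilde{X_{\alpha_i}}\cap\widetilde{X_{\alpha_{i+1}}}\ne\emptyset$ for every $i\in\{0,\dots,p-1\}$. Fixed data: $M>0$; a sequence $(\mu_n)_{n\in\mathbb{N}}$ of sequences $\mu_n=(z^n_k)_{k\in\mathbb{N}}$ with $0<z^n_{k+1}\le z^n_k\le M$ for all $k,n$, $\lim_{k\to\infty}z^n_k=0$ and $d^{\mu_n}\le M$ for every $n$, and such that for all $x,y\in A$ with $x\ne y$ there exists $n$ with $d^{\mu_n}(x,y)>0$. Then $\eta=(z_k)_{k\in\mathbb{N}}$ with $z_k=\sum_{n=0}^\infty\frac{1}{2^n}z^n_k$,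 and $\delta=d^\eta$. $(c_n)_{n\in\mathbb{N}}$ is a fixed strictly increasing sequence of real numbers with $c_0=1$, $\left(\frac{c_n}{c_{n+1}}\right)_{n\in\mathbb{N}}$ strictly increasing, and $c_n\le 2$, $\frac12\le\frac{c_n}{c_{n+1}}$ for every $n\in\mathbb{N}$. *)

(* Defs.v *)
From HB Require Import structures.
From mathcomp Require Import all_boot all_order all_algebra.
From mathcomp Require Import all_classical all_reals all_analysis.

Set Implicit Arguments.
Unset Strict Implicit.
Unset Printing Implicit Defensive.

Import Order.TTheory GRing.Theory Num.Theory.
Import numFieldNormedType.Exports.

Local Open Scope classical_set_scope.
Local Open Scope ring_scope.

Section words.
Variables (X : Type) (I : finType) (f : I -> X -> X).
Implicit Types (w : seq I) (alpha beta : nat -> I).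

(* Finite words are sequences over I. An infinite word is a function
   alpha : nat -> I whose value alpha k is the letter of index k.+1, so that its
   prefix of length n is mkseq alpha n. *)

Definition word_fun w : X -> X := foldr (fun i g => f i \o g) id w.

Definition word_set w : set X := range (word_fun w).

(* is_address alpha a says that the intersection of the sets attached to the
   prefixes of alpha has a as its unique element, i.e. that a = a_alpha. *)
Definition is_address alpha (a : X) : Prop :=
  \bigcap_n word_set (mkseq alpha n) = [set a].

Definition has_attractor : Prop :=
  (forall alpha, exists a, is_address alpha a) /\
  (forall alpha beta a b, is_address alpha a -> is_address beta b -> a <> b ->
    exists n, word_set (mkseq alpha n) `&` word_set (mkseq beta n) = set0).

Definition attractor : set X := [set a | exists alpha, is_address alpha a].

Definition limit_set w : set X :=
  [set a | exists beta, is_address beta a /\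
     forall n, word_set w `&` word_set (mkseq beta n) !=set0].

Definition word_set_ext w : set X := word_set w `|` limit_set w.

Variable R : realType.
Implicit Type z : nat -> R.

Definition chain_sums z (x y : X) : set R :=
  [set s | exists (p : nat) (w : nat -> seq I),
     [/\ word_set_ext (w 0%N) x, word_set_ext (w p) y,
         (forall i, (i < p)%N ->
            word_set_ext (w i) `&` word_set_ext (w i.+1) !=set0) &
         s = \sum_(0 <= i < p.+1) z (size (w i))]].

(* For positive z, chain_sums z x y is bounded below by 0, and it contains z 0
   (a chain reduced to the empty word), so inf is a genuine infimum here. *)
Definition chain_dist z (x y : X) : R :=
  if `[< x = y >] then 0 else inf (chain_sums z x y).

(* For bounded c and delta = chain_dist z with z positive, the set is nonempty and
   bounded (delta <= z 0), so sup is a genuine supremum. *)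
Definition weighted_dist (c : nat -> R) (delta : X -> X -> R) (x y : X) : R :=
  sup [set c (size w) * delta (word_fun w x) (word_fun w y) | w in [set: seq I]].

End words.

(* When the z n k are positive and uniformly bounded, the series converges and
   limn is its actual sum. *)
Definition weighted_seq (R : realType) (z : nat -> nat -> R) (k : nat) : R :=
  limn (series (fun n => (2 ^+ n)^-1 * z n k)).

Section metric.
Variables (R : realType) (X : Type).
Implicit Type d : X -> X -> R.

Record is_metric d : Prop := IsMetric {
  is_metric_xx : forall x, d x x = 0 ;
  is_metric_eq : forall x y, d x y = 0 -> x = y ;
  is_metric_sym : forall x y, d x y = d y x ;
  is_metric_triangle : forall y x z, d x z <= d x y + d y z
}.

(* Nonnegativity follows from the other axioms, as in the factory isMetric. *)
Definition metric_space d (m : is_metric d) : Type := X.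

HB.instance Definition _ d (m : is_metric d) := gen_eqMixin (metric_space m).
HB.instance Definition _ d (m : is_metric d) := gen_choiceMixin (metric_space m).
HB.instance Definition _ d (m : is_metric d) :=
  isMetric.Build R (metric_space m) (is_metric_xx m) (is_metric_eq m)
    (is_metric_sym m) (is_metric_triangle m).

Lemma mdist_metric_space d (m : is_metric d) (x y : metric_space m) :
  mdist x y = d x y.
Proof. by []. Qed.

End metric.

Definition bounded_space (R : realType) (T : metricType R) : Prop :=
  exists C : R, forall x y : T, mdist x y <= C.

Definition complete_space (R : realType) (T : metricType R) : Prop :=
  forall u : nat -> T, cauchy (u @ \oo) -> exists l : T, u @ \oo --> l.

(* Main.v *)
Require Import Defs.
From mathcomp Require Import all_boot all_order all_algebra.
From mathcomp Require Import zify lra.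
From mathcomp Require Import all_classical all_reals all_analysis.

Set Implicit Arguments.
Unset Strict Implicit.
Unset Printing Implicit Defensive.

Import Order.TTheory GRing.Theory Num.Theory.
Import numFieldNormedType.Exports.

Local Open Scope classical_set_scope.
Local Open Scope ring_scope.

(** The distance [d] is squeezed between [delta] and [2 * delta]. Applying [f i]
    to every link of a chain prepends the letter [i] to the words of the chain
    (lemma [word_set_ext_cons], which is where the existence of all addresses
    enters), and the weights do not increase with length, so [delta] does not
    increase under [f i]. As [c] takes its values between [1] and [2], with
    [c 0 = 1], the supremum defining [d] lies between [delta] and [2 * delta].
    Boundedness, separation and completeness can thus be read off [delta].

    All compactness comes from König's lemma ([konig]) on the finitely
    branching tree of words.

    - Separation. If [x] is not in the attractor, the words [w] with [x] in
      [word_set w] have bounded length, since an infinite branch would be an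
      address of [x]. A chain leaving [x] must start with such a word, hence
      weighs at least some [eta N > 0]. If both points are in the attractor,
      some [chain_dist (z n)] separates them, and [eta] dominates
      [2 ^ - n * z n].

    - Completeness. For a Cauchy sequence [u], König's lemma is applied to the
      tree of words [w] such that [word_set_ext w] contains some [u n] with
      [size w <= n]. Along an infinite branch [alpha], a chain with the single
      link [mkseq alpha m] joins such a [u n] to the point of address [alpha],
      and its weight [eta m] tends to [0]: this point is a cluster point, hence
      the limit. Without infinite branch, late terms of [u] only lie in sets of
      short words, hence two distinct late terms are at distance at least some
      [eta N > 0], so [u] is eventually constant. *)

(** * König's lemma for words *)

(** Either the tree has an infinite branch or its words have bounded length.
    The branch is built by keeping an initial word with arbitrarily long
    extensions in the tree; as there are finitely many letters, one of them
    preserves this property. *)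
Lemma konig (I : finType) (T : seq I -> Prop) :
  (forall w v, T (w ++ v) -> T w) ->
  (exists alpha : nat -> I, forall k, T (mkseq alpha k)) \/
  (exists N, forall w, (N <= size w)%N -> ~ T w).
Proof.
move=> Tpre.
pose big w := forall k, exists2 v, (k <= size v)%N & T (w ++ v).
have step w : big w -> exists i, big (rcons w i).
  move=> bigw; apply/not_existsP => small.
  have /choice[k kP] i : exists k,
      forall v, (k <= size v)%N -> ~ T (rcons w i ++ v).
    have /existsNP[k nk] := small i; exists k => v kv Tv.
    by apply: nk; exists v.
  have [[//|i v] /= sv Tv] := bigw (\max_i k i).+1.
  apply: (kP i v); last by rewrite cat_rcons.
  exact: leq_trans (leq_bigmax i) sv.
have [big0|small0] := pselect (big [::]); last first.
  right; have /existsNP[N nN] := small0.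
  by exists N => w Nw Tw; apply: nN; exists w.
have [i0 _] := step _ big0.
have /choice[g gP] w : exists i, big w -> big (rcons w i).
  have [/step[i bigi]|nbig] := pselect (big w); first by exists i.
  by exists i0 => /nbig.
pose W n := iter n (fun w => rcons w (g w)) [::].
have bigW n : big (W n) by elim: n => //= n; apply: gP.
left; exists (g \o W) => k.
have -> : mkseq (g \o W) k = W k by elim: k => // k IH; rewrite mkseqS IH.
by have [v _] := bigW k 0%N; apply: Tpre.
Qed.

(** * The sets attached to words *)

Section word_sets.
Variables (X : Type) (I : finType) (f : I -> X -> X).
Implicit Types (w v : seq I) (alpha beta : nat -> I).

Lemma word_set_nil x : word_set f [::] x.
Proof. by exists x. Qed.

Lemma word_set_prefix w v : word_set f (w ++ v) `<=` word_set f w.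
Proof.
move=> _ [x _ <-]; exists (word_fun f v x) => //.
by elim: w => //= i w ->.
Qed.

Lemma word_set_cons i w x : word_set f w x -> word_set f (i :: w) (f i x).
Proof. by move=> [y _ <-]; exists y. Qed.

Lemma word_set_address alpha a k :
  is_address f alpha a -> word_set f (mkseq alpha k) a.
Proof.
move=> aP; have : [set a] a by [].
by rewrite -aP; apply.
Qed.

Lemma address_eq alpha a x : is_address f alpha a ->
  (forall k, word_set f (mkseq alpha k) x) -> x = a.
Proof.
move=> aP xP; have : [set a] x by rewrite -aP => k _.
by [].
Qed.

Lemma word_set_ext_nil x : word_set_ext f [::] x.
Proof. by left; apply: word_set_nil. Qed.

Lemma word_set_ext_prefix w v : word_set_ext f (w ++ v) `<=` word_set_ext f w.
Proof.
move=> x [/word_set_prefix|[beta [xP meet]]]; first by left.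
right; exists beta; split => // n.
by have [y [/word_set_prefix wy yn]] := meet n; exists y.
Qed.

Hypothesis f_attractor : has_attractor f.

(** An infinite branch of the tree of words whose sets contain [x] would be an
    address of [x]. *)
Lemma bounded_words x : ~ attractor f x ->
  exists N, forall w, (N <= size w)%N -> ~ word_set f w x.
Proof.
move=> nAx.
have [|[alpha alphaP]|//] := @konig _ (fun w => word_set f w x).
  by move=> w v; apply: word_set_prefix.
have [a aP] := f_attractor.1 alpha.
by case: nAx; exists alpha; rewrite (address_eq aP alphaP).
Qed.

Lemma bounded_words_ext x : ~ attractor f x ->
  exists N, forall w, (N <= size w)%N -> ~ word_set_ext f w x.
Proof.
move=> nAx; have [N NP] := bounded_words nAx.
exists N => w /NP nwx [//|[beta [xP _]]].
by apply: nAx; exists beta.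
Qed.

(** Uniqueness alone does not make [f i a] an address: it is the existence of an
    address point for the word [i] followed by [alpha] that lets [f i a], a
    member of all the sets involved, be identified with it. *)
Lemma address_cons i alpha a : is_address f alpha a ->
  exists2 beta, is_address f beta (f i a) &
    forall k, mkseq beta k.+1 = i :: mkseq alpha k.
Proof.
move=> aP; pose beta k := if k is k'.+1 then alpha k' else i.
have betaS k : mkseq beta k.+1 = i :: mkseq alpha k.
  by rewrite /mkseq /= (iotaDl 1 0) -map_comp.
exists beta => //; have [b bP] := f_attractor.1 beta.
rewrite (address_eq bP (x := f i a)) // => -[|k].
  exact: word_set_nil.
by rewrite betaS; apply: word_set_cons; apply: word_set_address.
Qed.

Lemma word_set_ext_cons i w x :
  word_set_ext f w x -> word_set_ext f (i :: w) (f i x).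
Proof.
move=> [wx|[alpha [xP meet]]]; first by left; apply: word_set_cons.
right; have [beta fxP betaS] := address_cons i xP.
exists beta; split => // k; have [y [wy yk]] := meet k.-1.
exists (f i y); split; first exact: word_set_cons.
case: k yk => [_|k]; first exact: word_set_nil.
by rewrite betaS; apply: word_set_cons.
Qed.

End word_sets.

(** * Chain distances *)

Section chain_distance.
Variables (R : realType) (X : Type) (I : finType) (f : I -> X -> X).
Variable z : nat -> R.
Hypothesis z_gt0 : forall k, 0 < z k.

Let z_ge0 k : 0 <= z k. Proof. exact: ltW. Qed.

Lemma chain_sums_ge x y s : chain_sums f z x y s ->
  exists2 w, word_set_ext f w x & z (size w) <= s.
Proof.
move=> [p [w [w0x _ _ ->]]]; exists (w 0%N) => //.
by rewrite big_ltn // lerDl sumr_ge0.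
Qed.

Lemma chain_sums_ge0 x y s : chain_sums f z x y s -> 0 <= s.
Proof. by move=> /chain_sums_ge[w _]; apply: le_trans. Qed.

Lemma chain_sums1 w x y : word_set_ext f w x -> word_set_ext f w y ->
  chain_sums f z x y (z (size w)).
Proof.
move=> wx wy; exists 0%N, (fun=> w); split => //.
by rewrite big_nat1.
Qed.

Lemma chain_sums_sym x y : chain_sums f z x y `<=` chain_sums f z y x.
Proof.
move=> s [p [w [w0x wpy link ->]]].
exists p, (fun i => w (p - i)%N); split; rewrite ?subn0 ?subnn //.
  move=> i ip; have := link (p - i.+1)%N.
  by rewrite -subSn // subSS setIC; apply; lia.
rewrite big_nat_rev /=; apply: eq_big_nat => i _.
by rewrite add0n subSS.
Qed.

(** Concatenation of chains: the common point [y] makes the last link of the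
    first chain meet the first link of the second one. *)
Lemma chain_sums_cat x y t s1 s2 : chain_sums f z x y s1 ->
  chain_sums f z y t s2 -> chain_sums f z x t (s1 + s2).
Proof.
move=> [p [v [v0x vpy vlink ->]]] [q [w [w0y wqt wlink ->]]].
exists (p.+1 + q)%N, (fun i => if (i <= p)%N then v i else w (i - p.+1)%N).
split => //.
- by rewrite ifF ?addKn//; lia.
- move=> i ipq; case: (ltngtP i p) => ip.
  + exact: vlink.
  + by rewrite subSn //; apply: wlink; lia.
  + by rewrite ip subnn; exists y.
- rewrite -addnS [RHS](@big_cat_nat _ _ _ p.+1) /= ?leq_addr //; congr +%R.
    by apply: eq_big_nat => i /andP[_ ip]; rewrite ifT.
  rewrite -{1}[p.+1]add0n big_addn addKn; apply: eq_big_nat => i _.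
  by rewrite addnK ifF //; lia.
Qed.

Lemma chain_dist_xx x : chain_dist f z x x = 0.
Proof. by rewrite /chain_dist; case: asboolP. Qed.

Lemma chain_dist_le x y s : chain_sums f z x y s -> chain_dist f z x y <= s.
Proof.
move=> xys; rewrite /chain_dist; case: asboolP => _.
  exact: chain_sums_ge0 xys.
by apply: ge_inf => //; exists 0 => t /chain_sums_ge0.
Qed.

Lemma chain_dist_ge x y b : x <> y ->
  (forall s, chain_sums f z x y s -> b <= s) -> b <= chain_dist f z x y.
Proof.
move=> xy bP; rewrite /chain_dist; case: asboolP => // _.
apply: lb_le_inf => //; exists (z 0%N).
exact: (chain_sums1 (w := [::])) (word_set_ext_nil _ _) (word_set_ext_nil _ _).
Qed.

Lemma chain_dist_ge0 x y : 0 <= chain_dist f z x y.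
Proof.
have [->|xy] := pselect (x = y); first by rewrite chain_dist_xx.
by apply: chain_dist_ge => // s /chain_sums_ge0.
Qed.

Lemma chain_dist_link w x y : word_set_ext f w x -> word_set_ext f w y ->
  chain_dist f z x y <= z (size w).
Proof. by move=> wx wy; apply/chain_dist_le/chain_sums1. Qed.

Lemma chain_dist_sym x y : chain_dist f z x y = chain_dist f z y x.
Proof.
rewrite /chain_dist (asbool_equiv_eq (Q := y = x)); last by split.
by case: asboolP => // _; congr inf; apply/seteqP; split; apply: chain_sums_sym.
Qed.

Lemma chain_dist_triangle y x t :
  chain_dist f z x t <= chain_dist f z x y + chain_dist f z y t.
Proof.
have [->|xy] := pselect (x = y); first by rewrite chain_dist_xx add0r.
have [<-|yt] := pselect (y = t); first by rewrite chain_dist_xx addr0.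
rewrite -lerBlDr; apply: chain_dist_ge => // s1 xy1.
rewrite lerBlDl -lerBlDr; apply: chain_dist_ge => // s2 yt2.
by rewrite lerBlDl addrC chain_dist_le // addrC; apply: chain_sums_cat yt2.
Qed.

Hypothesis z_decr : forall k, z k.+1 <= z k.

Let z_homo k l : (k <= l)%N -> z l <= z k.
Proof. by move: k l; apply/nonincreasing_seqP. Qed.

(** The first word of a chain leaving [x] is one whose extended set contains
    [x], hence is shorter than [N], and its weight alone reaches [z N]. *)
Lemma chain_dist_ge_bounded x y N : x <> y ->
  (forall w, (N <= size w)%N -> ~ word_set_ext f w x) ->
  z N <= chain_dist f z x y.
Proof.
move=> xy NP; apply: chain_dist_ge => // s /chain_sums_ge[w wx].
apply: le_trans; apply: z_homo; rewrite leqNgt; apply/negP => /ltnW.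
by move=> /NP.
Qed.

Hypothesis f_attractor : has_attractor f.

(** Prepending the letter [i] to every word of a chain from [x] to [y] gives a
    chain from [f i x] to [f i y] whose weight is not larger. *)
Lemma chain_dist_letter i x y :
  chain_dist f z (f i x) (f i y) <= chain_dist f z x y.
Proof.
have [->|xy] := pselect (x = y); first by rewrite !chain_dist_xx.
apply: chain_dist_ge => // _ [p [w [w0x wpy link ->]]].
apply: (@le_trans _ _ (\sum_(0 <= j < p.+1) z (size (i :: w j)))); last first.
  by apply: ler_sum => j _; apply: z_decr.
apply: chain_dist_le; exists p, (fun j => i :: w j); split => //.
- exact: word_set_ext_cons.
- exact: word_set_ext_cons.
- move=> j /link[t [wt wSt]].
  by exists (f i t); split; apply: word_set_ext_cons.
Qed.

Lemma chain_dist_word w x y :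
  chain_dist f z (word_fun f w x) (word_fun f w y) <= chain_dist f z x y.
Proof.
by elim: w => //= i w; apply: le_trans; apply: chain_dist_letter.
Qed.

Lemma chain_dist_gt0_notin x y : ~ attractor f x -> x <> y ->
  0 < chain_dist f z x y.
Proof.
move=> nAx xy; have [N NP] := bounded_words_ext f_attractor nAx.
exact: lt_le_trans (z_gt0 N) (chain_dist_ge_bounded xy NP).
Qed.

End chain_distance.

Lemma chain_dist_scale (R : realType) (X : Type) (I : finType)
    (f : I -> X -> X) (z1 z2 : nat -> R) (r : R) x y :
  (forall k, 0 < z1 k) -> (forall k, 0 < z2 k) ->
  (forall k, r * z1 k <= z2 k) -> 0 < r ->
  r * chain_dist f z1 x y <= chain_dist f z2 x y.
Proof.
move=> z1_gt0 z2_gt0 z12 r_gt0.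
have [->|xy] := pselect (x = y); first by rewrite !chain_dist_xx mulr0.
apply: chain_dist_ge => // _ [p [w [w0x wpy link ->]]].
apply: (@le_trans _ _ (r * \sum_(0 <= i < p.+1) z1 (size (w i)))).
  by rewrite ler_pM2l //; apply: chain_dist_le => //; exists p, w.
by rewrite mulr_sumr; apply: ler_sum.
Qed.

(** * The weighted distance *)

Section weighted_distance.
Variables (R : realType) (X : Type) (I : finType) (f : I -> X -> X).
Variables (z c : nat -> R).
Hypotheses (f_attractor : has_attractor f) (z_gt0 : forall k, 0 < z k).
Hypotheses (z_decr : forall k, z k.+1 <= z k) (c0 : c 0%N = 1).
Hypotheses (c_ge0 : forall k, 0 <= c k) (c_le2 : forall k, c k <= 2).

Local Notation delta := (chain_dist f z).
Local Notation d := (weighted_dist f c delta).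

Let term_le x y w :
  c (size w) * delta (word_fun f w x) (word_fun f w y) <= 2 * delta x y.
Proof.
by apply: ler_pM => //; [exact: chain_dist_ge0|exact: chain_dist_word].
Qed.

Let term_le_sup x y w :
  c (size w) * delta (word_fun f w x) (word_fun f w y) <= d x y.
Proof.
apply: ub_le_sup; last by exists w.
by exists (2 * delta x y) => _ [v _ <-].
Qed.

Let sup_le x y b :
  (forall w, c (size w) * delta (word_fun f w x) (word_fun f w y) <= b) ->
  d x y <= b.
Proof.
move=> bP; apply: ge_sup => [|_ [w _ <-] //].
by exists (c 0%N * delta x y), [::].
Qed.

Lemma weighted_dist_le x y : d x y <= 2 * delta x y.
Proof. exact: sup_le. Qed.

Lemma weighted_dist_ge x y : delta x y <= d x y.
Proof. by have := term_le_sup x y [::]; rewrite /= c0 mul1r. Qed.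

Lemma weighted_dist_sym x y : d x y = d y x.
Proof.
by apply/le_anti/andP; split; apply: sup_le => w; rewrite chain_dist_sym.
Qed.

Lemma weighted_dist_triangle y x t : d x t <= d x y + d y t.
Proof.
apply: sup_le => w.
apply: le_trans (lerD (term_le_sup x y w) (term_le_sup y t w)).
by rewrite -mulrDr ler_wpM2l // chain_dist_triangle.
Qed.

Hypothesis delta_sep : forall x y, x <> y -> 0 < delta x y.

Lemma weighted_dist_metric : is_metric d.
Proof.
split.
- move=> x; apply/le_anti/andP; split.
    by apply: (le_trans (weighted_dist_le x x)); rewrite chain_dist_xx mulr0.
  by apply: le_trans (weighted_dist_ge x x); rewrite chain_dist_xx.
- move=> x y dxy; apply: contrapT => /delta_sep; apply/negP.
  by rewrite -leNgt -dxy weighted_dist_ge.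
- exact: weighted_dist_sym.
- exact: weighted_dist_triangle.
Qed.

Lemma weighted_dist_bounded x y : d x y <= 2 * z 0%N.
Proof.
apply: (le_trans (weighted_dist_le x y)); rewrite ler_pM2l //.
exact: (@chain_dist_link _ _ _ _ _ z_gt0 [::])
  (word_set_ext_nil _ _) (word_set_ext_nil _ _).
Qed.

Hypothesis z_lim : forall e, 0 < e -> exists m0, forall m, (m0 <= m)%N -> z m < e.

(** The tree explored is that of the words whose extended set is visited by [u]
    at a time at least their length: bounding the time by the length makes it
    closed under prefixes, and forces the visits along a branch to be
    arbitrarily late. *)
Lemma weighted_dist_complete (u : nat -> X) :
  (forall e, 0 < e ->
     exists N, forall n m, (N <= n)%N -> (N <= m)%N -> d (u n) (u m) < e) ->
  exists l, forall e, 0 < e -> exists N, forall n, (N <= n)%N -> d l (u n) < e.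
Proof.
move=> u_cauchy.
have [] := @konig _ (fun w => exists2 n, (size w <= n)%N &
    word_set_ext f w (u n)).
- move=> w v [n wvn wn]; exists n; last exact: word_set_ext_prefix wn.
  by apply: leq_trans wvn; rewrite size_cat leq_addr.
- move=> [alpha visits]; have [a aP] := f_attractor.1 alpha.
  exists a => e e_gt0.
  have [N NP] := u_cauchy (e / 2) (divr_gt0 e_gt0 (ltr0Sn _ 1)).
  (* The distance to [u n] is at most [2 * z m], hence the target [e / 4]. *)
  have [m0 m0P] := z_lim (divr_gt0 e_gt0 (ltr0Sn _ 3)).
  exists N => n Nn.
  pose m := maxn N m0; have [n' + un'] := visits m.
  rewrite size_mkseq => mn'.
  have da : d a (u n') < e / 2.
    apply: (le_lt_trans (weighted_dist_le _ _)).
    have wa : word_set_ext f (mkseq alpha m) a.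
      by left; apply: word_set_address.
    have := chain_dist_link z_gt0 wa un'; rewrite size_mkseq.
    have := m0P m (leq_maxr _ _); lra.
  have dn : d (u n') (u n) < e / 2.
    by apply: NP => //; apply: leq_trans mn'; apply: leq_maxl.
  apply: (le_lt_trans (weighted_dist_triangle (u n') _ _)); lra.
- move=> [m mP].
  have late n w : (m <= n)%N -> (m <= size w)%N -> ~ word_set_ext f w (u n).
    move=> mn mw wn; apply: (mP (take m w)); first by rewrite size_takel.
    exists n; first by rewrite size_takel.
    by apply: (@word_set_ext_prefix _ _ _ _ (drop m w)); rewrite cat_take_drop.
  have [N NP] := u_cauchy (z m) (z_gt0 m).
  exists (u (maxn N m)) => e e_gt0; exists (maxn N m) => n.
  rewrite geq_max => /andP[Nn mn].
  suff -> : u (maxn N m) = u n.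
    by rewrite (is_metric_xx weighted_dist_metric).
  apply: contrapT => neq.
  have := NP _ _ (leq_maxl N m) Nn; apply/negP; rewrite -leNgt.
  apply: le_trans (weighted_dist_ge _ _).
  apply: chain_dist_ge_bounded => // w; apply: late; exact: leq_maxr.
Qed.

End weighted_distance.

(** * The weighted sum of the weight sequences *)

Section weighted_sum.
Variables (R : realType) (M : R) (z : nat -> nat -> R).
Hypotheses (z_gt0 : forall n k, 0 < z n k) (z_le : forall n k, z n k <= M).

Let M_ge0 : 0 <= M. Proof. exact: le_trans (ltW (z_gt0 0 0)) (z_le 0 0). Qed.

Let S k := series (fun n => (2 ^+ n)^-1 * z n k).

Let pow2_gt0 n : 0 < (2 ^+ n)^-1 :> R.
Proof. by rewrite invr_gt0 exprn_gt0. Qed.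

Let S_homo k : {homo S k : n m / (n <= m)%N >-> n <= m}.
Proof.
apply/nondecreasing_seqP => n.
by rewrite /S seriesSr lerDl mulr_ge0 // ltW.
Qed.

(** [2 * M * 2 ^ - n] bounds the tail of the series after [n] terms; adding it
    turns the partial sums into a nonincreasing sequence. *)
Let S_tail k n m : S k m <= S k n + 2 * M * (2 ^+ n)^-1.
Proof.
have [/S_homo Smn|/ltnW nm] := leqP m n.
  by apply: (le_trans (Smn k)); rewrite lerDl !mulr_ge0 // ltW.
apply: (@le_trans _ _ (S k m + 2 * M * (2 ^+ m)^-1)).
  by rewrite lerDl !mulr_ge0 // ltW.
move: n m nm; apply/nonincreasing_seqP => n.
rewrite /S seriesSr exprS invfM -addrA lerD2l.
have := ler_wpM2l (ltW (pow2_gt0 n)) (z_le n k); lra.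
Qed.

Let S_cvg k : cvgn (S k).
Proof.
apply: nondecreasing_is_cvgn => //.
by exists (S k 0%N + 2 * M * (2 ^+ 0)^-1) => _ [n _ <-].
Qed.

Let S_le_sum k n : S k n <= weighted_seq z k.
Proof. exact: nondecreasing_cvgn_le. Qed.

Lemma weighted_seq_ge n k : (2 ^+ n)^-1 * z n k <= weighted_seq z k.
Proof.
apply: le_trans (S_le_sum k n.+1).
rewrite /S seriesSr lerDr /series /= sumr_ge0 // => i _.
by rewrite mulr_ge0 // ltW.
Qed.

Lemma weighted_seq_gt0 k : 0 < weighted_seq z k.
Proof. by apply: lt_le_trans (weighted_seq_ge 0 k); rewrite mulr_gt0. Qed.

Lemma weighted_seq_le_tail k n :
  weighted_seq z k <= S k n + 2 * M * (2 ^+ n)^-1.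
Proof.
apply: (@limr_le _ _ _ _ _ (S k)); first exact: S_cvg.
by exists 0%N => // m _; apply: S_tail.
Qed.

Lemma weighted_seq_decr : (forall n k, z n k.+1 <= z n k) ->
  forall k, weighted_seq z k.+1 <= weighted_seq z k.
Proof.
move=> z_decr k; apply: (@limr_le _ _ _ _ _ (S k.+1)); first exact: S_cvg.
exists 0%N => // n _.
apply: le_trans (S_le_sum k n); apply: ler_sum => i _.
by rewrite ler_wpM2l // ltW.
Qed.

Lemma weighted_seq_lim : (forall n, z n k @[k --> \oo] --> (0 : R)) ->
  forall e, 0 < e -> exists m0, forall m, (m0 <= m)%N -> weighted_seq z m < e.
Proof.
move=> z_lim e e_gt0.
have [n nP] : exists n, 2 * M * (2 ^+ n)^-1 < e / 2.
  have half1 : `|2^-1 : R| < 1 by rewrite ger0_norm; lra.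
  have /cvgrPdist_lt/(_ (e / 2)) := cvg_geometric (2 * M) half1.
  rewrite divr_gt0 // => /(_ isT)[n _ /(_ n (leqnn n))] /=.
  rewrite sub0r normrN ger0_norm ?mulr_ge0 ?exprn_ge0 ?invr_ge0 // exprVn.
  by move=> nP; exists n.
have S_lim : S k n @[k --> \oo] --> (0 : R).
  have <- : \sum_(0 <= i < n) (0 : R) = 0 by rewrite big1_eq.
  apply: cvg_big => [|i _]; first exact: add_continuous.
  by rewrite -(mulr0 (2 ^+ i)^-1); apply: cvgMr.
have /cvgrPdist_lt/(_ (e / 2)) := S_lim.
rewrite divr_gt0 // => /(_ isT)[m0 _ m0P].
exists m0 => m /m0P /=; rewrite sub0r normrN => Sm.
apply: (le_lt_trans (weighted_seq_le_tail m n)).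
have := ler_norm (S m n); lra.
Qed.

End weighted_sum.

Theorem proposition3p16 (R : realType) (X : Type) (I : finType)
  (f : I -> X -> X) (M : R) (z : nat -> nat -> R) (c : nat -> R)
  (I_neq0 : (0 < #|I|)%N)
  (f_attractor : has_attractor f)
  (M_gt0 : 0 < M)
  (z_gt0 : forall n k, 0 < z n k.+1)
  (z_decr : forall n k, z n k.+1 <= z n k)
  (z_le : forall n k, z n k <= M)
  (z_lim : forall n, z n k @[k --> \oo] --> (0 : R))
  (dist_le : forall n x y, chain_dist f (z n) x y <= M)
  (dist_sep : forall x y, attractor f x -> attractor f y -> x <> y ->
     exists n, 0 < chain_dist f (z n) x y)
  (c0 : c 0%N = 1)
  (c_incr : forall n, c n < c n.+1)
  (c_ratio_incr : forall n, c n / c n.+1 < c n.+1 / c n.+2)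
  (c_le2 : forall n, c n <= 2)
  (c_ratio_ge : forall n, 1 / 2 <= c n / c n.+1) :
  exists m : is_metric
      (weighted_dist f c (chain_dist f (weighted_seq z))),
    bounded_space (metric_space m) /\ complete_space (metric_space m).
Proof.
have z_gt0' n k : 0 < z n k by apply: lt_le_trans (z_gt0 n k) (z_decr n k).
have c_ge0 k : 0 <= c k.
  by elim: k => [|k IH]; [rewrite c0|exact: le_trans IH (ltW (c_incr k))].
pose eta := weighted_seq z.
have eta_gt0 : forall k, 0 < eta k := weighted_seq_gt0 z_gt0' z_le.
have eta_decr := weighted_seq_decr z_gt0' z_le z_decr.
have delta_sep x y : x <> y -> 0 < chain_dist f eta x y.
  move=> xy; have [Ax|nAx] := pselect (attractor f x); last first.
    exact: chain_dist_gt0_notin.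
  have [Ay|nAy] := pselect (attractor f y); last first.
    by rewrite chain_dist_sym chain_dist_gt0_notin // => /esym.
  have [n n_sep] := dist_sep x y Ax Ay xy.
  have pow2_gt0 : 0 < (2 ^+ n)^-1 :> R by rewrite invr_gt0 exprn_gt0.
  apply: lt_le_trans (mulr_gt0 pow2_gt0 n_sep) _.
  by apply: chain_dist_scale => // k; apply: (weighted_seq_ge z_gt0' z_le).
exists (weighted_dist_metric f_attractor eta_gt0 eta_decr c0 c_ge0 c_le2
  delta_sep); split.
  by exists (2 * eta 0%N) => x y; apply: weighted_dist_bounded.
move=> u /cauchy_ballP u_cauchy.
have [|l lP] := weighted_dist_complete f_attractor eta_gt0 eta_decr c0 c_ge0
  c_le2 delta_sep (weighted_seq_lim z_gt0' z_le z_lim) (u := u).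
  move=> e e_gt0; have [[A B] /= [[N1 _ N1P] [N2 _ N2P]] AB] := u_cauchy e e_gt0.
  exists (maxn N1 N2) => n m; rewrite !geq_max => /andP[n1 _] /andP[_ m2].
  have := AB (u n, u m); rewrite /= ballEmdist; apply; split.
    exact: N1P.
  exact: N2P.
exists l; apply/cvg_ballP => e /lP[N NP].
by exists N => // n /NP; rewrite /= ballEmdist.
Qed.
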